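(* Let $n,r$ be positive integers with $n\ge 2r$ and let $\mathbf{s}=(s_1,\dots,s_n)$ be a sequence of positive integers. Then the generalized pendant complete graph $K_n^{\mathbf{s}}$ has the $r$-EKR property.
   Context: All graphs are finite and simple. For a graph $G$ and $r\in\mathbb{N}$, $\mathcal{I}^{(r)}(G)$ denotes the family of independent $r$-subsets of $V(G)$. A subfamily $\mathcal{A}\subseteq\mathcal{I}^{(r)}(G)$ is intersecting if every two members have nonempty intersection. For $v\in V(G)$, the $r$-star centered at $v$ is $\{A\in\mathcal{I}^{(r)}(G): v\in A\}$. A graph $G$ has the $r$-EKR property (is $r$-EKR) if every largest intersecting subfamily of $\mathcal{I}^{(r)}(G)$ is an $r$-star, i.e., all its members contain a common vertex. The generalized pendant complete graph $K_n^{\mathbf{s}}$ is obtained from the complete graph $K_n$ with vertices $v_1,\dots,v_n$ by attaching, for each $i\in[n]$, a new clique $K_{s_i}$ with vertices $v^i_1,\dots,v^i_{s_i}$, each of which is adjacent to $v_i$ and to no other vertex of $K_n$ (distinct attached cliques have no edges between them). *)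

(* Defs.v *)
From mathcomp Require Import all_boot.
Set Implicit Arguments.
Unset Strict Implicit.
Unset Printing Implicit Defensive.

Record sgraph := SGraph {
  vertex :> finType;
  adj : rel vertex;
  adj_sym : symmetric adj;
  adj_irr : irreflexive adj
}.

Definition independent (G : sgraph) (A : {set G}) : bool :=
  [forall x in A, forall y in A, ~~ adj x y].

Definition indep_family (G : sgraph) (r : nat) : {set {set G}} :=
  [set A : {set G} | independent A & #|A| == r].

Definition intersecting (V : finType) (F : {set {set V}}) : Prop :=
  forall A B, A \in F -> B \in F -> A :&: B != set0.

Definition star (G : sgraph) (r : nat) (v : G) : {set {set G}} :=
  [set A in indep_family G r | v \in A].

(* "Largest" refers to cardinality, not to inclusion. *)
Definition largest_intersecting (G : sgraph) (r : nat) (F : {set {set G}}) :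
    Prop :=
  [/\ F \subset indep_family G r, intersecting F
    & forall F' : {set {set G}},
        F' \subset indep_family G r -> intersecting F' -> #|F'| <= #|F| ].

(* The strict form of the property: every largest intersecting subfamily, and
   not just one of them, is a star. *)
Definition EKR (G : sgraph) (r : nat) : Prop :=
  forall F : {set {set G}},
    largest_intersecting r F -> exists v : G, F = star r v.

Section GeneralizedPendantComplete.
Variables (n : nat) (s : 'I_n -> nat).

(* [inl i] is the vertex v_i of K_n; [inr (Tagged _ k)], with k : 'I_(s i), is
   the vertex of index k in the clique attached to v_i. *)
Definition gpc_vertex : finType := ('I_n + {i : 'I_n & 'I_(s i)})%type.

Definition gpc_adj : rel gpc_vertex := fun x y =>
  match x, y with
  | inl i, inl j => i != j
  | inl i, inr q => tag q == i
  | inr p, inl j => tag p == j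
  | inr p, inr q => (tag p == tag q) && (p != q)
  end.

Lemma gpc_adj_sym : symmetric gpc_adj.
Proof.
by move=> [i|p] [j|q] //=; rewrite eq_sym // [q == p]eq_sym.
Qed.

Lemma gpc_adj_irr : irreflexive gpc_adj.
Proof. by move=> [i|p] /=; rewrite ?eqxx. Qed.

Definition gen_pendant_complete : sgraph := SGraph gpc_adj_sym gpc_adj_irr.

End GeneralizedPendantComplete.

(* Main.v *)
(* Call pend i the vertex v^i_1. Replacing any other vertex of the i-th clique
   {v_i} + K_{s_i} by pend i preserves independence, so a largest intersecting
   family F can be shifted towards the pends. Once F is stable, any two members
   already share a pend, so the traces T(A) = {i | pend i \in A} intersect.
   Let s_{i0} = m be minimal. Split F according to the set D of vertices of A of
   index >= m in their clique and to t = |T(A)|. Within such a layer, the number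
   of members with a given trace depends only on t, because the remaining
   vertices can be relabelled by permutations of the indices; so the
   Erdos-Ko-Rado theorem bounds the layer by that of the star at pend i0.
   Equality must hold everywhere; for D empty and t = r - 1 < n / 2 the
   uniqueness part of Erdos-Ko-Rado forces a common index, which then lies in
   all traces. Shifting is undone with the connectedness of Kneser graphs. *)
Require Import Defs.
From mathcomp Require Import all_boot perm zify.
Set Implicit Arguments.
Unset Strict Implicit.
Unset Printing Implicit Defensive.

(** * Shifting a set family from [x] to [y] *)

Section Shift.
Variables (V : finType) (x y : V).
Implicit Types (A B U : {set V}) (F base : {set {set V}}).

Definition move A := if (x \in A) && (y \notin A) then y |: A :\ x else A.

(** Staying put when the image is already taken keeps the map injective on [F]. *)
Definition shift_in F A := if move A \in F then A else move A.

Definition shift F := [set shift_in F A | A in F].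

Lemma move_stay F A : A \in F -> move A \notin F ->
  [/\ x \in A, y \notin A & move A = y |: A :\ x].
Proof.
by rewrite /move; case: ifP => [/andP[xA yA]|_ ->].
Qed.

Lemma shift_inj F : {in F &, injective (shift_in F)}.
Proof.
move=> A B AF BF; rewrite /shift_in.
case: ifPn => hA; case: ifPn => hB //.
- by move=> eAB; rewrite -eAB AF in hB.
- by move=> eAB; rewrite eAB BF in hA.
have [xA yA ->] := move_stay AF hA; have [xB yB ->] := move_stay BF hB.
move=> /setP e; apply/setP => z; have := e z; rewrite !inE.
case: (eqVneq z x) => [->|_]; first by rewrite xA xB.
by case: (eqVneq z y) => [->|_] //=; rewrite (negPf yA) (negPf yB).
Qed.

Lemma card_shift F : #|shift F| = #|F|.
Proof. exact: card_in_imset (@shift_inj F). Qed.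

(** Two moved sets share [y]. A moved [B] still meets a set [A] that stays: either [y] lies in [A],
    or one of [A], [move A] is a member of [F] whose common point with [B] is neither [x] nor [y],
    hence lies in both [A] and [move B]. *)
Lemma shift_intersecting F : intersecting F -> intersecting (shift F).
Proof.
move=> iF.
have mixed A B : A \in F -> B \in F -> move A \in F -> move B \notin F ->
    A :&: move B != set0.
  move=> AF BF mA mB; have [xB yB ->] := move_stay BF mB.
  apply/set0Pn; case: (boolP (y \in A)) => yA.
    by exists y; rewrite !inE yA eqxx.
  case: (boolP (x \in A)) => xA.
    move: mA; rewrite /move xA yA /= => mA.
    have /set0Pn[z] := iF _ _ mA BF; rewrite !inE => /andP[/orP[/eqP->|]].
      by rewrite (negPf yB).
    by case/andP=> zx zA zB; exists z; rewrite !inE zA zx zB orbT.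
  have /set0Pn[z] := iF _ _ AF BF; rewrite !inE => /andP[zA zB].
  exists z; rewrite !inE zA zB andbT /=; apply/orP; right.
  by apply: contraNneq xA => <-.
move=> _ _ /imsetP[A AF ->] /imsetP[B BF ->]; rewrite /shift_in.
case: ifPn => mA; case: ifPn => mB; first exact: iF.
- exact: mixed.
- by rewrite setIC; apply: mixed.
have [_ _ ->] := move_stay AF mA; have [_ _ ->] := move_stay BF mB.
by apply/set0Pn; exists y; rewrite !inE eqxx.
Qed.

(** Makes repeated shifting terminate: [A] really moves, and no member gains weight. *)
Lemma sum_shift_lt F (f : {set V} -> nat) A :
  (forall B, B \in F -> x \in B -> y \notin B -> f (y |: B :\ x) < f B) ->
  A \in F -> x \in A -> y \notin A -> y |: A :\ x \notin F ->
  \sum_(B in shift F) f B < \sum_(B in F) f B.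
Proof.
move=> hf AF xA yA mA; rewrite big_imset /=; last exact: shift_inj.
rewrite [ltnLHS](bigD1 A) //= [ltnRHS](bigD1 A) //= -addSn leq_add //.
  by rewrite /shift_in /move xA yA /= (negPf mA) hf.
apply: leq_sum => B /andP[BF _]; rewrite /shift_in; case: ifPn => // mB.
by have [xB yB ->] := move_stay BF mB; rewrite ltnW ?hf.
Qed.

(* Labelling a base set [U] by which of [x |: U], [y |: U] lies in [F], disjoint
   base sets get the same label, so the label is constant. *)
Lemma unshift F base :
  intersecting F ->
  (forall l : {set V} -> bool,
      {in base &, forall U1 U2, [disjoint U1 & U2] -> l U1 = l U2} ->
      {in base &, forall U1 U2, l U1 = l U2}) ->
  {in shift F, forall A, y \in A} ->
  {in base, forall U, [/\ x \notin U, y \notin U & y |: U \in shift F]} ->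
  {in F, forall A, x \in A -> y \notin A -> A :\ x \in base} ->
  {in F, forall A, y \in A -> x \notin A -> A :\ y \in base} ->
  x != y ->
  {in F, forall A, y \in A} \/ {in F, forall A, x \in A}.
Proof.
move=> iF conn hy hb hx' hy' xy.
have inshift A : A \in F -> move A \in F -> A \in shift F.
  by move=> AF mA; apply/imsetP; exists A => //; rewrite /shift_in mA.
(* A member without [x] is fixed by [move], so it survives the shift and contains [y]. *)
have xory A : A \in F -> (x \in A) || (y \in A).
  move=> AF; apply/orP; case: (boolP (x \in A)) => xA; [by left|right].
  have mA : move A = A by rewrite /move (negPf xA).
  by apply/hy/inshift; rewrite ?mA.
case: (boolP [forall A in F, y \in A]) => [/forall_inP|]; first by left.
case/forall_inPn => A AF yA.
right=> B BF; case: (boolP (x \in B)) => // xB; exfalso.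
have xA : x \in A by have := xory A AF; rewrite (negPf yA) orbF.
have yB : y \in B by have := xory B BF; rewrite (negPf xB).
have := conn (fun U => y |: U \in F).
(* If [y |: U2] were not in [F], it would be the image of [x |: U2], a member of [F] disjoint from
   [y |: U1]. *)
have hl : {in base &, forall U1 U2, [disjoint U1 & U2] ->
      y |: U1 \in F -> y |: U2 \in F}.
  move=> U1 U2 b1 b2 dis U1F; apply/negPn/negP => U2F.
  have [x1 y1 _] := hb _ b1; have [x2 y2 /imsetP[C CF eC]] := hb _ b2.
  move: eC; rewrite /shift_in; case: ifPn => [_ eC|mC].
    by rewrite eC CF in U2F.
  have [xC yC ->] := move_stay CF mC => /setP eC.
  have /set0Pn[z] := iF _ _ CF U1F; rewrite !inE => /andP[zC /orP[/eqP zy|z1]].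
    by rewrite -zy zC in yC.
  have := eC z; rewrite !inE zC andbT.
  have zx : z != x by apply: contraNneq x1 => <-.
  have zy : z != y by apply: contraNneq y1 => <-.
  rewrite (negPf zy) zx /= => z2.
  by rewrite (disjointFr dis z1) in z2.
(* The label of [B :\ y] is true, hence so is that of [A :\ x]; then [A] survives the shift although
   it lacks [y]. *)
move=> /(_ _ (A :\ x) (B :\ y)) -/(_ _ (hx' _ AF xA yA) (hy' _ BF yB xB)).
rewrite setD1K // BF => e.
suff: y |: A :\ x \in F.
  move=> mA; have := hy A; rewrite (negPf yA) => h; suff: false by [].
  by apply/h/inshift => //; rewrite /move xA yA.
apply: e => U1 U2 b1 b2 dis; apply/idP/idP; apply: hl => //.
by rewrite disjoint_sym.
Qed.

End Shift.

(** * Exchange of elements and Kneser graphs *)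

Lemma card_swap (I : finType) (A : {set I}) a b :
  a \in A -> b \notin A -> #|b |: A :\ a| = #|A|.
Proof.
by move=> aA bA; rewrite cardsU1 !inE (negPf bA) andbF /= [RHS](cardsD1 a) aA.
Qed.

Lemma sub_swap (I : finType) (X A : {set I}) a b :
  A \subset X -> b \in X -> b |: A :\ a \subset X.
Proof.
move=> AX bX; apply/subsetP => z; rewrite !inE => /orP[/eqP->//|/andP[_]].
exact: (subsetP AX).
Qed.

(** Trading an element of [A :\: B] for one of [B :\: A] stays inside [X] and lowers [#|A :\: B|],
    so exchanges lead from [A] to [B]. *)
Lemma swap_const (I : finType) (R : Type) (X : {set I}) k (g : {set I} -> R) :
  (forall (A : {set I}) a b, A \subset X -> #|A| = k ->
     a \in A -> b \in X -> b \notin A -> g (b |: A :\ a) = g A) ->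
  forall A B : {set I}, A \subset X -> B \subset X -> #|A| = k -> #|B| = k ->
  g A = g B.
Proof.
move=> hg A B; move: {2}#|A :\: B| (leqnn #|A :\: B|) => d.
elim: d A => [|d IH] A hd AX BX eA eB.
  have AB : A \subset B by rewrite -setD_eq0 -cards_eq0 -leqn0.
  by congr g; apply/eqP; rewrite eqEcard AB eA eB leqnn.
case: (set_0Vmem (A :\: B)) => [e|[a]].
  by apply: IH => //; rewrite e cards0.
have [e|[b]] := set_0Vmem (B :\: A).
  have BA : B \subset A by rewrite -setD_eq0 e.
  have/eqP-> : A == B by rewrite eq_sym eqEcard BA eA eB leqnn.
  by rewrite setDv inE.
rewrite !inE => /andP[bA bB] /andP[aB aA].
have bX := subsetP BX _ bB.
rewrite -(hg A a b) //; apply: IH => //; last 2 first.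
- exact: sub_swap.
- by rewrite card_swap.
rewrite -ltnS; apply: leq_trans hd; rewrite [ltnRHS](cardsD1 a) !inE aB aA /=.
rewrite add1n ltnS; apply: subset_leq_card; apply/subsetP => z.
by rewrite !inE; case: (eqVneq z b) => [->|_] /=; [rewrite bB|rewrite andbCA].
Qed.

Lemma subset_of_card (I : finType) (X : {set I}) k :
  k <= #|X| -> exists2 A : {set I}, A \subset X & #|A| = k.
Proof.
move=> kX; have : 0 < #|[set A : {set I} | A \subset X & #|A| == k]|.
  by rewrite cards_draws bin_gt0.
by case/card_gt0P => A; rewrite inE => /andP[AX /eqP]; exists A.
Qed.

(* Connectedness of the Kneser graph: [A] and [b |: A :\ a] are both disjoint
   from any [k]-subset of [X :\: (b |: A)]. *)
Lemma kneser_const (I : finType) (R : Type) (X : {set I}) k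
    (g : {set I} -> R) : 2 * k < #|X| ->
  (forall A B : {set I}, A \subset X -> B \subset X -> #|A| = k -> #|B| = k ->
     [disjoint A & B] -> g A = g B) ->
  forall A B : {set I}, A \subset X -> B \subset X -> #|A| = k -> #|B| = k ->
  g A = g B.
Proof.
move=> kX hg; apply: swap_const => A a b AX kA aA bX bA.
have [|C] := @subset_of_card _ (X :\: (b |: A)) k.
  have bAX : b |: A \subset X.
    by apply/subsetP => z; rewrite !inE => /orP[/eqP->//|/(subsetP AX)].
  by rewrite cardsD (setIidPr bAX) cardsU1 bA kA; lia.
rewrite subsetD disjoint_sym => /andP[CX dis] kC.
transitivity (g C); [|symmetry]; apply: hg => //.
- exact: sub_swap.
- by rewrite card_swap.
- apply: disjointWl dis; apply/subsetP => z; rewrite !inE.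
  by case/orP=> [->//|/andP[_ ->]]; rewrite orbT.
- by apply: disjointWl dis; apply: subsetUr.
Qed.

(** * The Erdos-Ko-Rado theorem with its uniqueness part *)

Lemma card_star (I : finType) (X : {set I}) k c : c \in X -> 0 < k ->
  #|[set A : {set I} | [&& A \subset X, c \in A & #|A| == k]]|
    = 'C(#|X|.-1, k.-1).
Proof.
move=> cX k0; have -> : #|X|.-1 = #|X :\ c| by rewrite (cardsD1 c X) cX.
rewrite -cards_draws -[RHS](@card_in_imset _ _ (fun A => c |: A)); last first.
  move=> A B; rewrite !inE !subsetD1 => /andP[/andP[_ cA] _] /andP[/andP[_ cB] _].
  by move=> /(congr1 (fun Z => Z :\ c)); rewrite !setU1K.
apply: eq_card => A; rewrite inE; apply/and3P/imsetP.
  move=> [AX cA /eqP kA]; exists (A :\ c); last by rewrite setD1K.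
  by rewrite inE setSD //= (cardsD1 c A) cA in kA *; rewrite -kA.
case=> B; rewrite inE subsetD1 => /andP[/andP[BX cB] /eqP kB] ->.
rewrite subUset sub1set cX BX setU11 cardsU1 cB kB; split=> //.
by apply/eqP; lia.
Qed.

(** [F] and the family of complements of its members are disjoint and equally large, so [2 * #|F|]
    is at most ['C(2 * t, t)], which is twice ['C((2 * t).-1, t.-1)]. *)
Lemma ekr_complement (I : finType) (X : {set I}) t (F : {set {set I}}) :
  0 < t -> #|X| = 2 * t ->
  {in F, forall A : {set I}, A \subset X /\ #|A| = t} -> intersecting F ->
  #|F| <= 'C(#|X|.-1, t.-1).
Proof.
move=> t0 cX hF iF.
set G := [set X :\: A | A in F].
have cG : #|G| = #|F|.
  apply: card_in_imset => A B /hF[AX _] /hF[BX _] /(congr1 (setD X)).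
  by rewrite !setDDr !setDv !set0U (setIidPr AX) (setIidPr BX).
have dis : [disjoint F & G].
  rewrite -setI_eq0; apply/eqP/setP => A; rewrite !inE.
  apply/negP => /andP[AF /imsetP[B BF eA]].
  have /set0Pn[z] := iF _ _ AF BF.
  by rewrite eA !inE => /andP[/andP[/negPf->]].
have : #|F :|: G| <= 'C(#|X|, t).
  rewrite -cards_draws; apply/subset_leq_card/subsetP => A.
  rewrite !inE => /orP[/hF[-> ->]|/imsetP[B /hF[BX cB] ->]]; first exact: eqxx.
  by rewrite subsetDl cardsD (setIidPr BX) cB cX; apply/eqP; lia.
rewrite cardsU disjoint_setI0 // cards0 subn0 cG cX => h.
have := mul_bin_diag (2 * t) t.-1; rewrite prednK // => e.
rewrite -(leq_pmul2l (_ : 0 < 2 * t)) ?muln_gt0 // e; nia.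
Qed.

(* Shift a fixed element [x] out of the family; once no shift applies, the links
   at [x] intersect pairwise because [2 * t <= #|X|] leaves a replacement for
   [x] outside [A :|: B]. *)
Theorem erdos_ko_rado (I : finType) (X : {set I}) t (F : {set {set I}}) :
  0 < t -> 2 * t <= #|X| ->
  {in F, forall A : {set I}, A \subset X /\ #|A| = t} -> intersecting F ->
  #|F| <= 'C(#|X|.-1, t.-1) /\
  (2 * t < #|X| -> #|F| = 'C(#|X|.-1, t.-1) ->
     exists2 c, c \in X & {in F, forall A : {set I}, c \in A}).
Proof.
move eN: #|X| => N; elim: N X eN t F => [|N IH] X cX t F t0 tN hF iF; first lia.
case: (ltngtP (2 * t) N.+1) tN => // [tN|tN] _; last first.
  by split => //; rewrite -cX; apply: ekr_complement => //; rewrite cX.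
have [x xX] : exists x, x \in X by apply/card_gt0P; rewrite cX.
have cX' : #|X :\ x| = N by move: cX; rewrite (cardsD1 x) xX => -[].
have star_gt0 : 0 < 'C(N, t.-1) by rewrite bin_gt0; lia.
have elt c : #|F| = 'C(N, t.-1) -> {in F, forall A : {set I}, c \in A} -> c \in X.
  move=> eF hc; have /card_gt0P[A AF] : 0 < #|F| by rewrite eF.
  by have [/subsetP AX _] := hF _ AF; apply/AX/hc.
suff [h1 h2] : #|F| <= 'C(N, t.-1) /\ (#|F| = 'C(N, t.-1) ->
     exists c, {in F, forall A : {set I}, c \in A}).
  by split=> // _ eF; have [c hc] := h2 eF; exists c => //; apply: elt hc.
clear elt.
(* Inner induction on the number of members containing [x], which every effective shift lowers. *)
move eM : (\sum_(A in F) (x \in A)) => M.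
elim/ltn_ind: M F hF iF eM => M IHM F hF iF eM.
case: (boolP [exists A in F, [exists y in X,
  [&& x \in A, y \notin A & y |: A :\ x \notin F]]]).
  case/exists_inP => A AF /exists_inP[y yX /and3P[xA yA mA]].
  have xy : x != y by apply: contraNneq yA => <-.
  have hF' : {in shift x y F, forall A : {set I}, A \subset X /\ #|A| = t}.
    move=> _ /imsetP[B BF ->]; rewrite /shift_in; case: ifPn => [_|mB].
      exact: hF.
    have [BX cB] := hF _ BF; have [xB yB ->] := move_stay BF mB.
    by rewrite sub_swap // card_swap.
  have lt : \sum_(A in shift x y F) (x \in A) < M.
    rewrite -eM.
    apply: (@sum_shift_lt _ x y F (fun A : {set I} => x \in A : nat) A) => //.
    by move=> B BF xB yB; rewrite xB !inE eqxx /= orbF (negPf xy).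
  have [h1 h2] := IHM _ lt (shift x y F) hF' (shift_intersecting iF) erefl.
  rewrite -(card_shift x y F); split=> // /[dup] eF /h2[c hc].
  have full : shift x y F =
      [set A : {set I} | [&& A \subset X, c \in A & #|A| == t]].
    apply/eqP; rewrite eqEcard; apply/andP; split.
      apply/subsetP => B BF; have [BX cB] := hF' _ BF.
      by rewrite inE BX hc // cB eqxx.
    rewrite card_star // ?cX ?eF //.
    have /card_gt0P[B BF] : 0 < #|shift x y F| by rewrite eF.
    by have [/subsetP BX _] := hF' _ BF; apply/BX/hc.
  (* A centre other than [y] cannot be created by the shift, so [F] already had it. A centre [y] is
     handled by [unshift], with connectedness from [2 * t.-1 < N.-1]. *)
  case: (eqVneq c y) => [ecy|cy]; last first.
    exists c => B BF.
    have := hc _ (imset_f (shift_in x y F) BF).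
    rewrite /shift_in; case: ifPn => // mB.
    have [_ _ ->] := move_stay BF mB.
    by rewrite !inE (negPf cy) => /andP[].
  pose base := [set U : {set I} | (U \subset X :\ x :\ y) && (#|U| == t.-1)].
  have cX2 : #|X :\ x :\ y| = N.-1.
    by rewrite -cX' [in RHS](cardsD1 y) !inE eq_sym xy yX.
  case: (@unshift _ x y F base) => //; last 2 first.
  - by move=> h; exists y.
  - by move=> h; exists x.
  - move=> l hl U1 U2; rewrite !inE => /andP[s1 /eqP c1] /andP[s2 /eqP c2].
    apply: (@kneser_const _ _ (X :\ x :\ y) t.-1) => //; first by rewrite cX2; lia.
    move=> A1 A2 t1 t2 d1 d2 dis; apply: hl => //; rewrite inE.
      by rewrite t1 d1 eqxx.
    by rewrite t2 d2 eqxx.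
  - by move=> B /hc; rewrite ecy.
  - move=> U; rewrite inE !subsetD1 => /andP[/andP[/andP[UX xU] yU] /eqP cU].
    split=> //; rewrite full !inE ecy eqxx /= subUset sub1set yX UX.
    by rewrite cardsU1 yU cU; apply/eqP; lia.
  - move=> B /hF[BX cB] xB yB; rewrite inE subsetD1 !inE (negPf yB) andbF andbT.
    by rewrite setSD //=; rewrite (cardsD1 x) xB in cB; apply/eqP; lia.
  - move=> B /hF[BX cB] yB xB; rewrite inE setSD /=; last first.
      by rewrite subsetD1 BX.
    by rewrite (cardsD1 y) yB in cB; apply/eqP; lia.
move=> nshift.
have stable A y : A \in F -> y \in X -> x \in A -> y \notin A -> y |: A :\ x \in F.
  move=> AF yX xA yA; move: nshift; apply: contraNT => mA.
  by apply/exists_inP; exists A => //; apply/exists_inP; exists y => //; apply/and3P.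
clear nshift IHM eM M.
(* Members avoiding [x] and links at [x] both live on [N] points; their bounds add up by Pascal's
   rule. *)
pose F1 := [set A in F | x \notin A].
pose F2 := [set A :\ x | A in F & x \in A].
have cF2 : #|F2| = #|[set A in F | x \in A]|.
  rewrite card_in_imset => [|A B]; first by apply: eq_card => A; rewrite !inE.
  rewrite !inE => /andP[_ xA] /andP[_ xB] /(congr1 (setU [set x])).
  by rewrite !setD1K.
have cF : #|F| = #|F2| + #|F1|.
  rewrite cF2 -(cardsID [set A : {set I} | x \in A] F).
  by congr (_ + _); apply: eq_card => A; rewrite !inE // andbC.
have hF1 : {in F1, forall A : {set I}, A \subset X :\ x /\ #|A| = t}.
  by move=> A; rewrite inE => /andP[/hF[AX cA] xA]; rewrite subsetD1 AX.
have iF1 : intersecting F1.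
  by move=> A B; rewrite !inE => /andP[AF _] /andP[BF _]; apply: iF.
have hF2 : {in F2, forall A : {set I}, A \subset X :\ x /\ #|A| = t.-1}.
  move=> B /imsetP[A]; rewrite inE => /andP[/hF[AX cA] xA] ->.
  by rewrite setSD //; split=> //; rewrite (cardsD1 x) xA in cA; lia.
have iF2 : intersecting F2.
  move=> _ _ /imsetP[A hA ->] /imsetP[B hB ->].
  move: hA hB; rewrite !inE => /andP[AF xA] /andP[BF xB].
  have [AX cA] := hF _ AF; have [BX cB] := hF _ BF.
  have [y yX yAB] : exists2 y, y \in X & y \notin A :|: B.
    have /subsetPn[y yX yAB] : ~~ (X \subset A :|: B).
      apply/negP => /subset_leq_card; rewrite cX cardsU cA cB.
      by move: (A :&: B) (iF _ _ AF BF) => C; rewrite -card_gt0; lia.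
    by exists y.
  move: yAB; rewrite inE negb_or => /andP[yA yB].
  have /set0Pn[z] := iF _ _ (stable _ _ AF yX xA yA) BF.
  rewrite !inE => /andP[/orP[/eqP->|/andP[zx zA]] zB]; first by rewrite zB in yB.
  by apply/set0Pn; exists z; rewrite !inE zx zA zB.
have [b1 _] := IH _ cX' t F1 t0 tN hF1 iF1.
(* Singletons are treated apart, since induction on [F2] requires [0 < t.-1]. *)
case: (ltngtP t 1) => [|t1|t1]; first lia; last first.
  have eF A : A \in F -> F = [set A].
    move=> AF; apply/setP => B; rewrite inE; apply/idP/eqP => [BF|->//].
    have /set0Pn[z] := iF _ _ AF BF; rewrite inE => /andP[zA zB].
    have [_ /eqP] := hF _ AF; have [_ /eqP] := hF _ BF.
    rewrite t1 => /cards1P[b eB] /cards1P[a eA].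
    by move: zA zB; rewrite eA eB !inE => /eqP-> /eqP->.
  rewrite t1 bin0; have [->|[A AF]] := set_0Vmem F; first by rewrite cards0.
  rewrite (eF _ AF) cards1; split=> // _.
  have [_ cA] := hF _ AF; have /card_gt0P[c cc] : 0 < #|A| by rewrite cA.
  by exists c => B; rewrite inE => /eqP->.
have [||b2 u2] := IH _ cX' t.-1 F2 _ _ hF2 iF2; [lia|lia|].
have pascal : 'C(N, t.-1) = 'C(N.-1, t.-2) + 'C(N.-1, t.-1).
  have e1 : t.-2.+1 = t.-1 by lia.
  have e2 : N.-1.+1 = N by lia.
  by have := binS N.-1 t.-2; rewrite e1 e2 addnC.
rewrite cF pascal; split; first exact: leq_add.
(* Equality in the sum forces equality for [F2], where [2 * t.-1 < N] gives uniqueness; for [F1],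
   [2 * t] may equal [N]. *)
move=> eF; have [||c cX2 hc] := u2; first lia.
  by apply/eqP; rewrite eqn_leq b2 -(leq_add2r 'C(N.-1, t.-1)) -eF leq_add2l.
have full : F2 = [set A : {set I} | [&& A \subset X :\ x, c \in A & #|A| == t.-1]].
  apply/eqP; rewrite eqEcard; apply/andP; split.
    apply/subsetP => B BF; have [BX cB] := hF2 _ BF.
    by rewrite inE BX hc // cB eqxx.
  by rewrite card_star ?cX' //; lia.
exists c => A AF; case: (boolP (c \in A)) => // cA; exfalso.
have [AX kA] := hF _ AF.
(* With [C] avoiding [A], [x] and [c], the set [x |: (c |: C)] is a member of [F]. It can meet [A]
   only in [x], but then [A :\ x] is a link missing [c]. *)
have [|C] := @subset_of_card _ (X :\: A :\ x :\ c) t.-2.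
  have := cardsD1 x (X :\: A); have := cardsD1 c (X :\: A :\ x).
  have -> : #|X :\: A| = N.+1 - t by rewrite cardsD (setIidPr AX) cX kA.
  lia.
rewrite !subsetD1 subsetD => /andP[/andP[/andP[CX dis] xC] cC] kC.
have : c |: C \in F2.
  rewrite full inE subUset sub1set cX2 subsetD1 CX xC setU11 cardsU1 cC kC /=.
  by apply/eqP; lia.
case/imsetP => B; rewrite inE => /andP[BF xB] /setP eB.
have [_ cB] := hF _ BF.
have [xA|xA] := boolP (x \in A).
  have : A :\ x \in F2 by apply: imset_f; rewrite inE AF.
  by move/hc; rewrite !inE (negPf cA) andbF.
have /set0Pn[z] := iF _ _ AF BF; rewrite !inE => /andP[zA zB].
have := eB z; rewrite !inE zB (contraNneq _ xA) => [|<-//].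
by rewrite (disjointFl dis zA) orbF => /eqP ezc; rewrite -ezc zA in cA.
Qed.

(** * Stars and independent sets in an arbitrary graph *)

(** The star contains [F] and is itself intersecting, so maximality turns inclusion into
    equality. *)
Lemma largest_star (G : sgraph) r (F : {set {set G}}) (v : G) :
  largest_intersecting r F -> {in F, forall A : {set G}, v \in A} ->
  F = star r v.
Proof.
move=> [FI iF maxF] hv.
apply/eqP; rewrite eqEcard; apply/andP; split.
  by apply/subsetP => A AF; rewrite inE (subsetP FI) // hv.
apply: maxF; first by apply/subsetP => A; rewrite inE => /andP[].
move=> A B; rewrite !inE => /andP[_ vA] /andP[_ vB].
by apply/set0Pn; exists v; rewrite inE vA.
Qed.

Lemma independentP (G : sgraph) (A : {set G}) :
  reflect {in A &, forall u v, ~~ adj u v} (independent A).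
Proof.
apply: (iffP forall_inP) => [h u v uA vA|h u uA]; last first.
  by apply/forall_inP => v; apply: h.
by have /forall_inP := h u uA; apply.
Qed.

Lemma independent_sub (G : sgraph) (A B : {set G}) :
  B \subset A -> independent A -> independent B.
Proof.
move=> /subsetP BA /independentP iA; apply/independentP => u v uB vB.
by apply: iA; apply: BA.
Qed.

(** * Independent sets of the pendant complete graph *)

Section PendantComplete.
Variables (n : nat) (s : 'I_n -> nat).
Hypothesis s_gt0 : forall i, 0 < s i.
Local Notation G := (gen_pendant_complete s).
Implicit Types (A B U : {set G}) (F : {set {set G}}) (R T : {set 'I_n}).

Definition clique_of (v : G) : 'I_n :=
  match v with inl i => i | inr p => tag p end.

Definition is_core (v : G) : bool := if v is inl _ then true else false.

(** Replaces the four-way case split by a uniform view: the graph is a union of the cliques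
    [clique_of v = i] and of the clique on the core. *)
Lemma gpc_adjE (u v : G) :
  adj u v =
    (u != v) && ((clique_of u == clique_of v) || (is_core u && is_core v)).
Proof.
case: u v => [i|p] [j|q] /=; rewrite ?orbT ?andbT ?orbF // 1?eq_sym //.
exact: andbC.
Qed.

Definition pend (i : 'I_n) : G :=
  inr (Tagged (fun i => 'I_(s i)) (Ordinal (s_gt0 i))).

Lemma pend_inj : injective pend.
Proof. exact: (can_inj (g := clique_of)). Qed.

Lemma clique_of_inj A : independent A -> {in A &, injective clique_of}.
Proof.
move=> /independentP iA u v uA vA e; apply/eqP; have := iA u v uA vA.
by rewrite gpc_adjE e eqxx andbT negbK.
Qed.

Lemma independentU_pend A i :
  independent A -> {in A, forall v, clique_of v != i} ->
  independent (pend i |: A).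
Proof.
move=> /independentP iA hi; apply/independentP => u v; rewrite !inE.
case/orP=> [/eqP->|uA] /orP[/eqP->|vA]; rewrite ?gpc_adjE ?eqxx //=.
- by rewrite orbF [i == _]eq_sym (negPf (hi _ vA)) andbF.
- by rewrite andbF orbF (negPf (hi _ uA)) andbF.
- by have := iA u v uA vA; rewrite gpc_adjE.
Qed.

Lemma independent_pends R : independent (pend @: R).
Proof.
apply/independentP => u v /imsetP[i _ ->] /imsetP[j _ ->].
rewrite gpc_adjE /= orbF; case: (eqVneq i j) => [->|_]; rewrite ?eqxx ?andbF //.
Qed.

Definition trace A : {set 'I_n} := [set i | pend i \in A].

Lemma card_cliques A : independent A -> #|clique_of @: A| = #|A|.
Proof. by move=> iA; rewrite card_in_imset //; apply: clique_of_inj. Qed.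

(** [v] is the only vertex of [A] in its clique, and a pend has no neighbour outside its clique. *)
Lemma swap_pend_indep A v : independent A -> v \in A ->
  independent (pend (clique_of v) |: A :\ v).
Proof.
move=> iA vA; apply: independentU_pend.
  exact: independent_sub (subsetDl _ _) iA.
move=> u; rewrite !inE => /andP[uv uA]; apply: contraNneq uv => e.
exact/eqP/(clique_of_inj iA).
Qed.

Lemma pend_notin A v : independent A -> v \in A -> v != pend (clique_of v) ->
  pend (clique_of v) \notin A.
Proof.
move=> iA vA; apply: contraNN => pA; apply/eqP.
exact: (clique_of_inj iA).
Qed.

Definition stable F := forall A v, A \in F -> v \in A ->
  v != pend (clique_of v) -> pend (clique_of v) |: A :\ v \in F.

(** Induction on [#|A :&: B|]: a common vertex that is not a pend is replaced in [A] by the pend of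
    its clique. That pend is not in [B], so the intersection shrinks and the shared pend finally
    found was already in [A]. *)
Lemma stable_meet F : {in F, forall A, independent A} -> intersecting F ->
  stable F -> {in F &, forall A B, trace A :&: trace B != set0}.
Proof.
move=> indF iF sF A B; move eN: #|A :&: B| => N.
elim/ltn_ind: N A eN => N IH A eN AF BF.
have /set0Pn[v] := iF _ _ AF BF; rewrite inE => /andP[vA vB].
case: (eqVneq v (pend (clique_of v))) => [e|vp].
  by apply/set0Pn; exists (clique_of v); rewrite !inE -e vA vB.
have pB := pend_notin (indF _ BF) vB vp.
have sA := sF _ _ AF vA vp.
have e : (pend (clique_of v) |: A :\ v) :&: B = (A :&: B) :\ v.
  apply/setP => z; rewrite !inE.
  case: (eqVneq z (pend _)) => [->|_]; last by rewrite andbA.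
  by rewrite (negPf pB) !andbF.
have /set0Pn[j] : trace (pend (clique_of v) |: A :\ v) :&: trace B != set0.
  apply: (IH #|(A :&: B) :\ v|) => //; last by rewrite e.
  by rewrite -eN (cardsD1 v (A :&: B)) inE vA vB.
rewrite !inE (inj_eq pend_inj) => /andP[/orP[/eqP ej|/andP[_ jA]] jB].
  by rewrite -ej jB in pB.
by apply/set0Pn; exists j; rewrite !inE jA.
Qed.

(** * Counting independent sets layer by layer *)

Section Common.
Variable m : nat.
Hypothesis m_gt0 : 0 < m.
Hypothesis le_m_s : forall i, m <= s i.

(* Besides [pend i], of index 0, these are [m] vertices of every clique; they can
   be carried from any clique to any other. *)
Definition common (v : G) : bool :=
  match v with inl _ => true | inr p => (tagged p : nat) < m end.

Definition common_vertex (i : 'I_n) (k : 'I_m) : G :=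
  inr (Tagged (fun i => 'I_(s i)) (widen_ord (le_m_s i) k)).

(** Indices of at least [m] stay fixed because the target clique may be too small. Hence this need
    not be a graph automorphism. *)
Definition relabel (pi : 'I_n -> 'I_n) (v : G) : G :=
  match v with
  | inl i => inl (pi i)
  | inr p => if insub (tagged p : nat) is Some k
             then common_vertex (pi (tag p)) k else inr p
  end.

Lemma relabelK pi : involutive pi -> involutive (relabel pi).
Proof.
move=> piK [i|[i k]] /=; first by rewrite piK.
case: insubP => [u _ eu|/negPf h] /=.
  rewrite valK /= piK; congr inr; congr Tagged; exact: val_inj.
by rewrite insubF.
Qed.

Lemma relabel_core pi v : is_core (relabel pi v) = is_core v.
Proof. by case: v => [i|[i k]] //=; case: insubP. Qed.

Lemma relabel_common pi v : common (relabel pi v) = common v.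
Proof.
case: v => [i|[i k]] //=; case: insubP => [u -> _|/negPf //] /=.
exact: ltn_ord.
Qed.

Lemma relabel_extra pi v : ~~ common v -> relabel pi v = v.
Proof. by case: v => [i|[i k]] //=; case: insubP => // u ->. Qed.

Lemma clique_of_relabel pi v : common v ->
  clique_of (relabel pi v) = pi (clique_of v).
Proof. by case: v => [i|[i k]] //=; case: insubP => //= /negPf->. Qed.

Lemma relabel_pend pi i : relabel pi (pend i) = pend (pi i).
Proof.
rewrite /=; case: insubP => [u _ eu|]; last by rewrite m_gt0.
by congr inr; congr Tagged; apply: val_inj.
Qed.

Definition extra A : {set G} := [set v in A | ~~ common v].

Definition fiber r (D : {set G}) T : {set {set G}} :=
  [set A in indep_family G r | (extra A == D) && (trace A == T)].

(** Relabelling by the transposition of [a] and [b] is injective. It preserves independence here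
    because the vertices it leaves in place, those of [D], lie in cliques that the transposition
    fixes. *)
Lemma fiber_swap_le r (D : {set G}) T a b : a \in T -> b \notin T ->
  {in D, forall v, clique_of v != a} -> {in D, forall v, clique_of v != b} ->
  #|fiber r D T| <= #|fiber r D (b |: T :\ a)|.
Proof.
move=> aT bT aD bD; set f := relabel (tperm a b).
have fK : involutive f by apply/relabelK/tpermK.
have f_inj := inv_inj fK.
rewrite -(card_imset _ (imset_inj f_inj)); apply/subset_leq_card/subsetP => B.
case/imsetP => A; rewrite !inE => /andP[/andP[iA cA] /andP[/eqP eD /eqP eT]] ->.
have mem v : (v \in f @: A) = (f v \in A).
  by rewrite -{1}(fK v) mem_imset.
apply/andP; split; first (apply/andP; split).
- apply/independentP => _ _ /imsetP[u uA ->] /imsetP[v vA ->].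
  have := independentP _ iA u v uA vA.
  rewrite !gpc_adjE (inj_eq f_inj) !relabel_core; apply: contra.
  case/andP=> -> /orP[|->]; last by rewrite orbT.
  have fix_extra w : w \in A -> ~~ common w -> tperm a b (clique_of w) = clique_of w.
    move=> wA wx; have wD : w \in D by rewrite -eD inE wA.
    by rewrite tpermD // eq_sym ?aD ?bD.
  have tgf w : w \in A -> clique_of (f w) = tperm a b (clique_of w).
    move=> wA; case: (boolP (common w)) => wc; first exact: clique_of_relabel.
    by rewrite /f relabel_extra // fix_extra.
  by rewrite !tgf // (inj_eq perm_inj) => ->.
- by rewrite card_imset.
apply/andP; split; apply/eqP/setP.
  move=> v; rewrite -eD !inE mem; case: (boolP (common v)) => vc.
    by rewrite !andbF.
  by rewrite /f relabel_extra.
move=> i; rewrite !inE mem /f relabel_pend -eT inE.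
have := aT; have := bT; rewrite -eT !inE => /negPf pb pa.
case: tpermP => [->|->|/eqP/negPf ia /eqP/negPf ib].
- rewrite pb eqxx /= orbF; apply/esym/negbTE; apply: contraNneq bT => <-.
  by rewrite aT.
- by rewrite pa eqxx.
by rewrite ia ib.
Qed.

Lemma card_fiber r (D : {set G}) T1 T2 :
  {in D, forall v, clique_of v \notin T1} ->
  {in D, forall v, clique_of v \notin T2} -> #|T1| = #|T2| ->
  #|fiber r D T1| = #|fiber r D T2|.
Proof.
move=> h1 h2 e12.
have sub T : {in D, forall v, clique_of v \notin T} ->
    T \subset ~: (clique_of @: D).
  move=> h; apply/subsetP => i iT; rewrite inE; apply/imsetP => -[v vD ei].
  by have := h v vD; rewrite -ei iT.
apply: (@swap_const _ _ (~: (clique_of @: D)) #|T1| (fun T => #|fiber r D T|)).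
- move=> T a b TX _ aT bX bT.
  have out i : i \in ~: (clique_of @: D) -> {in D, forall v, clique_of v != i}.
    by rewrite inE => iD v vD; apply: contraNneq iD => <-; apply: imset_f.
  have aX := subsetP TX _ aT.
  have ab : a != b by apply: contraNneq bT => <-.
  apply/eqP; rewrite eqn_leq; apply/andP; split; last first.
    by apply: fiber_swap_le => //; apply: out.
  have {2}-> : T = a |: (b |: T :\ a) :\ b.
    by rewrite setU1K ?setD1K // !inE (negPf bT) andbF.
  apply: fiber_swap_le; [by rewrite !inE eqxx| |exact: out|exact: out].
  by rewrite !inE eqxx /= orbF.
- exact: sub.
- exact: sub.
- by [].
- by [].
Qed.

(** Ensures that an index whose clique size is the minimum [m] is never blocked by [D]. *)
Lemma extra_clique v : ~~ common v -> m < s (clique_of v).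
Proof.
case: v => [i|[i k]] //=; rewrite -leqNgt => mk.
exact: leq_ltn_trans mk (ltn_ord k).
Qed.

Lemma extra_clique_trace A v : independent A -> v \in extra A ->
  clique_of v \notin trace A.
Proof.
move=> iA; rewrite !inE => /andP[vA]; apply: contraNN => pA.
by rewrite (clique_of_inj iA vA pA).
Qed.

Lemma card_trace_extra A : #|trace A| + #|extra A| <= #|A|.
Proof.
rewrite -(card_imset _ pend_inj) -cardsUI.
have -> : pend @: trace A :&: extra A = set0.
  apply/setP => v; rewrite !inE; apply/negP => /andP[/imsetP[i _ ->]].
  by rewrite /= m_gt0 andbF.
rewrite cards0 addn0; apply/subset_leq_card/subsetP => v.
by rewrite !inE => /orP[/imsetP[i]|/andP[]//]; rewrite inE => iA ->.
Qed.

Definition layer (D : {set G}) t F : {set {set G}} :=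
  [set A in F | (extra A == D) && (#|trace A| == t)].

Lemma layer_le F r D t i0 : 2 * r <= n -> s i0 = m ->
  F \subset indep_family G r ->
  {in F &, forall A B, trace A :&: trace B != set0} ->
  #|layer D t F| <= #|layer D t (star r (pend i0))| /\
  (layer D t F != set0 -> #|layer D t F| = #|layer D t (star r (pend i0))| ->
   #|[set trace A | A in layer D t F]| = 'C(#|~: (clique_of @: D)|.-1, t.-1)).
Proof.
move=> rn si0 FI trF; set F' := layer D t F; set S' := layer D t _.
have [->|[A0 A0F]] := set_0Vmem F'; first by rewrite cards0 eqxx.
set X := ~: _.
have F'P A : A \in F' ->
    [/\ A \in F, independent A, #|A| = r, extra A = D & #|trace A| = t].
  rewrite inE => /and3P[AF /eqP eD /eqP et].
  by move: (subsetP FI _ AF); rewrite inE => /andP[iA /eqP cA].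
have [A0F0 iA0 cA0 eD0 et0] := F'P _ A0F.
have outX (T : {set 'I_n}) : T \subset X -> {in D, forall v, clique_of v \notin T}.
  move=> /subsetP TX v vD; apply/negP => /TX; rewrite inE.
  by rewrite imset_f.
have traceX A : independent A -> extra A = D -> trace A \subset X.
  move=> iA eD; apply/subsetP => i iT; rewrite inE; apply/imsetP => -[v vD ei].
  by have := @extra_clique_trace A v iA; rewrite eD -ei iT => /(_ vD).
have i0X : i0 \in X.
  rewrite inE; apply/imsetP => -[v]; rewrite -eD0 inE => /andP[_ /extra_clique].
  by move=> + e; rewrite -e si0 ltnn.
pose c := #|fiber r D (trace A0)|.
have cT (T : {set 'I_n}) : T \subset X -> #|T| = t -> #|fiber r D T| = c.
  move=> TX eT; apply: card_fiber; [exact: outX| |by rewrite eT et0].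
  exact/outX/traceX.
have c_gt0 : 0 < c by apply/card_gt0P; exists A0; rewrite !inE iA0 cA0 eD0 !eqxx.
have t_gt0 : 0 < t.
  by rewrite -et0 card_gt0; have := trF _ _ A0F0 A0F0; rewrite setIid.
(* From [t + #|D| <= r] and [#|X| = n - #|D|]. *)
have cX : 2 * t <= #|X|.
  have iD : independent D.
    rewrite -eD0; apply: independent_sub iA0; apply/subsetP => v.
    by rewrite inE => /andP[].
  have := card_trace_extra A0.
  rewrite [#|X|]cardsCs setCK card_ord card_cliques // eD0 et0 cA0.
  lia.
set TF := [set trace A | A in F'].
have le1 : #|F'| <= #|TF| * c.
  rewrite -sum1_card (partition_big trace (mem TF)) /=; last first.
    by move=> A AF; apply: imset_f.
  rewrite -sum_nat_const; apply: leq_sum => T /imsetP[A /F'P[_ iA _ eD et] eT].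
  rewrite -(cT T) ?eT //; last exact: traceX.
  rewrite sum1_card; apply/subset_leq_card/subsetP => B.
  rewrite [in X in X -> _]unfold_in => /andP[/F'P[_ iB cB eDB _] eTB].
  by rewrite !inE iB cB eDB eTB !eqxx.
have ekr_le : #|TF| <= 'C(#|X|.-1, t.-1).
  apply: (proj1 (@erdos_ko_rado _ X t TF t_gt0 cX _ _)).
    by move=> T /imsetP[A /F'P[_ iA _ eD et] ->]; split=> //; apply: traceX.
  move=> T1 T2 /imsetP[A /F'P[AF _ _ _ _] ->] /imsetP[B /F'P[BF _ _ _ _] ->].
  exact: trF.
have eS : #|S'| = 'C(#|X|.-1, t.-1) * c.
  rewrite -(card_star i0X t_gt0).
  set ST := [set _ | _].
  rewrite -sum1_card (partition_big trace (mem ST)) /=; last first.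
    move=> A; rewrite !inE => /andP[/andP[/andP[iA cA] pA] /andP[/eqP eD ->]].
    by rewrite traceX // pA.
  rewrite -sum_nat_const; apply: eq_bigr => T.
  rewrite inE => /and3P[TX iT /eqP et]; rewrite -(cT T) // sum1_card.
  apply: eq_card => B; rewrite [LHS]unfold_in !inE.
  case: (eqVneq (trace B) T) => [eT|_]; last by rewrite !andbF.
  rewrite eT et eqxx !andbT; have : i0 \in trace B by rewrite eT.
  by rewrite inE => ->; rewrite andbT.
split; first by rewrite eS (leq_trans le1) // leq_mul2r ekr_le orbT.
move=> _ e; apply/eqP; rewrite eqn_leq ekr_le /=.
by rewrite -(leq_pmul2r c_gt0) -eS -e.
Qed.

End Common.

(** * Stable largest families have a common pend *)

Lemma stable_star F r : 0 < n -> 0 < r -> 2 * r <= n ->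
  largest_intersecting r F -> stable F ->
  exists i, {in F, forall A, pend i \in A}.
Proof.
move=> n_gt0 r_gt0 rn lF sF; have [FI iF maxF] := lF.
have indF A : A \in F -> independent A /\ #|A| = r.
  by move/(subsetP FI); rewrite inE => /andP[iA /eqP].
have trF := stable_meet (fun A AF => proj1 (indF A AF)) iF sF.
pose i1 := Ordinal n_gt0.
case: (@arg_minnP _ i1 xpredT s isT) => i0 _ min_i0.
have le_m i : s i0 <= s i by apply: min_i0.
set S := star r (pend i0).
have FS : #|S| <= #|F|.
  apply: maxF; first by apply/subsetP => A; rewrite inE => /andP[].
  move=> A B; rewrite !inE => /andP[_ iA] /andP[_ iB].
  by apply/set0Pn; exists (pend i0); rewrite inE iA.
case: (ltngtP r 1) => [|r1|r1]; first lia; last first.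
  have [->|[A AF]] := set_0Vmem F; first by exists i1 => A; rewrite inE.
  have /set0Pn[i] := trF _ _ AF AF; rewrite setIid inE => iA.
  exists i => B BF; have /set0Pn[j] := trF _ _ AF BF.
  rewrite !inE => /andP[jA jB].
  have [_ /eqP] := indF _ AF; rewrite r1 => /cards1P[v eA].
  by move: iA jA; rewrite eA !inE => /eqP-> /eqP<-.
pose m := s i0.
pose key A : {set G} * 'I_n.+1 := (extra m A, inord #|trace A|).
have keyE (E : {set {set G}}) :
    #|E| = \sum_(k : {set G} * 'I_n.+1) #|layer m k.1 k.2 E|.
  rewrite -sum1_card (partition_big key xpredT) //=; apply: eq_bigr => -[D t] _.
  rewrite sum1_card; apply: eq_card => A; rewrite [LHS]unfold_in inE.
  congr (_ && _); rewrite xpair_eqE; congr (_ && _).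
  rewrite -val_eqE /= inordK // ltnS -[leqRHS]card_ord; exact: max_card.
have leS := @layer_le _ (s_gt0 i0) le_m F r _ _ i0 rn erefl FI trF.
(* Layerwise [F] is at most [S], while in total [S] is at most [F]; so no layer can be strictly
   smaller. *)
have eqS D t : t <= n -> #|layer m D t F| = #|layer m D t S|.
  move=> tn; apply/eqP; rewrite eqn_leq (proj1 (leS D t)) leqNgt; apply/negP => lt.
  move: FS; rewrite leqNgt (keyE F) (keyE S).
  rewrite [X in X < _](bigD1 (D, inord t)) //= [X in _ < X](bigD1 (D, inord t)) //=.
  rewrite inordK // -addSn leq_add //; apply: leq_sum => k _.
  exact: (proj1 (leS _ _)).
have X0 : ~: (clique_of @: (set0 : {set G})) = setT by rewrite imset0 setC0.
have cX : #|[set: 'I_n]| = n by rewrite cardsT card_ord.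
have [T0 iT0 cT0] : exists2 T : {set 'I_n}, i0 \in T & #|T| = r.-1.
  have [|C] := @subset_of_card _ [set~ i0] r.-2.
    by rewrite cardsC1 card_ord; lia.
  rewrite subsetC sub1set inE => iC cC; exists (i0 |: C); first exact: setU11.
  by rewrite cardsU1 iC cC; lia.
have [j jT0] : exists j, j \notin T0.
  have : 0 < #|~: T0| by rewrite cardsCs setCK card_ord cT0; lia.
  by case/card_gt0P => j; rewrite inE; exists j.
have Sne : layer m set0 r.-1 S != set0.
  (* The core vertex [inl j] supplies an [r]-th vertex that is neither a pend nor extra, even if all
     attached cliques are single vertices. *)
  pose A0 : {set G} := (inl j : G) |: pend @: T0.
  have jP : (inl j : G) \notin pend @: T0 by apply/imsetP => -[].
  have tA0 : trace A0 = T0.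
    by apply/setP => i; rewrite !inE /= mem_imset //; apply: pend_inj.
  apply/set0Pn; exists A0; rewrite !inE tA0 cT0 eqxx andbT.
  rewrite mem_imset ?iT0; last exact: pend_inj.
  rewrite orbT andbT cardsU1 jP card_imset; last exact: pend_inj.
  rewrite cT0 [(_ + _ == r)](_ : _ = true) ?andbT; last by apply/eqP; lia.
  apply/andP; split.
    have iP := independentP _ (independent_pends T0).
    apply/independentP => u v; rewrite !inE.
    case/orP=> [/eqP->|uT] /orP[/eqP->|vT]; last exact: iP.
    - by rewrite gpc_adjE eqxx.
    - case/imsetP: vT => i iT ->; rewrite gpc_adjE /= orbF.
      by apply: contraNneq jT0 => ->.
    - case/imsetP: uT => i iT ->; rewrite gpc_adjE /= orbF.
      by apply: contraNneq jT0 => <-.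
  apply/eqP/setP => v; rewrite !inE; apply/negP => /andP[/orP[/eqP->//|]].
  by case/imsetP => i _ ->; rewrite /= /m s_gt0.
have eL : #|layer m set0 r.-1 F| = #|layer m set0 r.-1 S| by apply: eqS; lia.
have Fne : layer m set0 r.-1 F != set0 by rewrite -card_gt0 eL card_gt0.
have := proj2 (leS set0 r.-1) Fne eL; rewrite X0.
set TF := [set _ | _ in _] => cTF.
have TFP T : T \in TF -> exists A, [/\ A \in F, trace A = T & #|T| = r.-1].
  by case/imsetP => A; rewrite inE => /and3P[AF _ /eqP cA] ->; exists A.
have hTF : {in TF, forall T, T \subset [set: 'I_n] /\ #|T| = r.-1}.
  by move=> T /TFP[A [_ _ cT]]; split; first exact: subsetT.
have iTF : intersecting TF.
  by move=> T1 T2 /TFP[A [AF <- _]] /TFP[B [BF <- _]]; apply: trF.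
(* The choice of [r.-1] instead of [r] makes the inequality strict even when [n = 2 * r]. *)
have [|||c _ hc] := proj2 (erdos_ko_rado _ _ hTF iTF) _ cTF;
  rewrite ?cX; [lia|lia|lia|].
have full : TF = [set T : {set 'I_n} | [&& T \subset setT, c \in T & #|T| == r.-1]].
  apply/eqP; rewrite eqEcard; apply/andP; split.
    apply/subsetP => T TT; have [_ /eqP cT] := hTF _ TT.
    by rewrite inE subsetT hc.
  by rewrite card_star ?inE ?cTF //; lia.
exists c => A AF; case: (boolP (pend c \in A)) => // cA; exfalso.
have [iA kA] := indF _ AF.
have ktA : #|trace A| <= r by have := card_trace_extra (s_gt0 i0) A; rewrite kA; lia.
(* If [A] lacks [pend c], then [c |: C] is the trace of a member and is disjoint from [trace A]. *)
have [|C] := @subset_of_card _ (~: trace A :\ c) r.-2.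
  have := cardsD1 c (~: trace A); have := cardsC (trace A); rewrite card_ord; lia.
rewrite subsetD1 subsetC => /andP[CA cC] kC.
have : c |: C \in TF.
  by rewrite full !inE subsetT eqxx /= cardsU1 cC kC; apply/eqP; lia.
case/TFP => B [BF eB _].
have /set0Pn[i] := trF _ _ AF BF; rewrite eB !inE => /andP[iAi /orP[/eqP ec|iC]].
  by rewrite -ec iAi in cA.
by have := subsetP CA i; rewrite !inE iAi iC => /(_ isT).
Qed.

(** * Undoing the shifts towards the pends *)

(** Each [U] is disjoint from a set of pends over indices that its cliques avoid. This reduces the
    claim to the Kneser graph of [r.-1]-subsets of [n.-1] indices, connected since
    [2 * r.-1 < n.-1]. *)
Lemma base_connected i r (base : {set {set G}}) :
  0 < r -> 2 * r <= n ->
  base = [set U : {set G} |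
    [&& independent U, #|U| == r.-1 & i \notin clique_of @: U]] ->
  forall l : {set G} -> bool,
  {in base &, forall U1 U2, [disjoint U1 & U2] -> l U1 = l U2} ->
  {in base &, forall U1 U2, l U1 = l U2}.
Proof.
move=> r_gt0 rn -> l hl.
have cX : #|[set~ i]| = n.-1 by rewrite cardsC1 card_ord.
have pbase R : R \subset [set~ i] -> #|R| = r.-1 -> pend @: R \in
    [set U : {set G} | [&& independent U, #|U| == r.-1 & i \notin clique_of @: U]].
  move=> RX cR; rewrite inE independent_pends.
  rewrite card_imset ?cR ?eqxx; last exact: pend_inj.
  apply/imsetP => -[_ /imsetP[j jR ->] /= ij].
  by have := subsetP RX j jR; rewrite !inE ij eqxx.
have to_pends U : U \in [set U : {set G} |
    [&& independent U, #|U| == r.-1 & i \notin clique_of @: U]] ->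
    exists R, [/\ R \subset [set~ i], #|R| = r.-1 & l U = l (pend @: R)].
  move=> bU; have := bU; rewrite inE => /and3P[iU /eqP cU iNU].
  have [|R] := @subset_of_card _ ([set~ i] :\: clique_of @: U) r.-1.
    have UX : clique_of @: U \subset [set~ i] by rewrite subsetC sub1set inE.
    by rewrite cardsD (setIidPr UX) cX card_cliques ?cU //; lia.
  rewrite subsetD => /andP[RX dis] cR; exists R; split=> //.
  apply: hl => //; first exact: pbase.
  rewrite -setI_eq0; apply/eqP/setP => v; rewrite !inE; apply/negP => /andP[vU].
  case/imsetP => j jR ev; have := disjointFr dis jR.
  by rewrite (_ : j = clique_of v) ?imset_f // ev.
move=> U1 U2 /to_pends[R1 [R1X cR1 ->]] /to_pends[R2 [R2X cR2 ->]].
apply: (@kneser_const _ _ [set~ i] r.-1 (fun R => l (pend @: R))) => //.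
  by rewrite cX; lia.
move=> A B AX BX cA cB dis; apply: hl; try exact: pbase.
rewrite -setI_eq0 -imsetI; last by move=> ? ? _ _; apply: pend_inj.
by rewrite (disjoint_setI0 dis) imset0.
Qed.

Lemma largest_common_vertex F r : 0 < n -> 0 < r -> 2 * r <= n ->
  largest_intersecting r F -> exists v, {in F, forall A, v \in A}.
Proof.
move=> n_gt0 r_gt0 rn.
(* The number of vertices that are not pends drops whenever a set is moved, which gives the
   induction. *)
pose f A := #|[set v in A | v != pend (clique_of v)]|.
move eM : (\sum_(A in F) f A) => M; elim/ltn_ind: M F eM => M IH F eM lF.
have [FI iF maxF] := lF.
have indF A : A \in F -> independent A /\ #|A| = r.
  by move/(subsetP FI); rewrite inE => /andP[iA /eqP].
case: (boolP [exists A in F, [exists v in A, (v != pend (clique_of v)) &&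
   (pend (clique_of v) |: A :\ v \notin F)]]); last first.
  move=> h; have [|i hi] := stable_star n_gt0 r_gt0 rn lF; last by exists (pend i).
  move=> A v AF vA vp; move: h; apply: contraNT => mA.
  by apply/exists_inP; exists A => //; apply/exists_inP; exists v; rewrite ?vp.
case/exists_inP => A AF /exists_inP[x xA /andP[xp mA]].
set i := clique_of x in xp mA; set y := pend i in xp mA.
have yx : y != x by rewrite eq_sym.
have cF' := card_shift x y F.
have lF' : largest_intersecting r (shift x y F).
  split; [|exact: shift_intersecting|by rewrite cF'].
  apply/subsetP => _ /imsetP[B BF ->]; rewrite /shift_in; case: ifPn => [_|mB].
    exact: (subsetP FI).
  have [iB cB] := indF _ BF; have [xB yB ->] := move_stay BF mB.
  by rewrite inE card_swap // cB eqxx andbT swap_pend_indep.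
have lt : \sum_(B in shift x y F) f B < M.
  rewrite -eM; apply: (@sum_shift_lt _ x y F f A) => //.
    move=> B BF xB yB; rewrite /f [ltnRHS](cardsD1 x) !inE xB xp /= add1n ltnS.
    apply/subset_leq_card/subsetP => v; rewrite !inE.
    by case: (eqVneq v y) => [->|_] /=; [rewrite eqxx|rewrite andbA].
  by have [iA _] := indF _ AF; apply: pend_notin.
have [u hu] := IH _ lt _ erefl lF'.
case: (eqVneq u y) => [euy|uy]; last first.
  exists u => B BF; have := hu _ (imset_f (shift_in x y F) BF).
  rewrite /shift_in; case: ifPn => // mB; have [_ _ ->] := move_stay BF mB.
  by rewrite !inE (negPf uy) => /andP[].
have hy B : B \in shift x y F -> y \in B by move/hu; rewrite euy.
have eF' := largest_star lF' hy.
(* Both [x] and [y] lie in clique [i], so removing either from a member leaves a set with no vertex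
   in that clique. *)
pose base := [set U : {set G} |
    [&& independent U, #|U| == r.-1 & i \notin clique_of @: U]].
have hbase z B : clique_of z = i -> B \in F -> z \in B -> B :\ z \in base.
  move=> ez BF zB; have [iB cB] := indF _ BF.
  rewrite inE (independent_sub (subsetDl _ _) iB) /=; apply/andP; split.
    by rewrite -cB (cardsD1 z B) zB.
  apply/imsetP => -[v]; rewrite !inE => /andP[vz vB] ev.
  by move: vz; rewrite (clique_of_inj iB vB zB) ?eqxx // -ev ez.
have := @unshift _ x y F base iF (@base_connected i r base r_gt0 rn erefl) hy.
case; first 1 last.
- by move=> B BF xB _; apply: hbase.
- by move=> B BF yB _; apply: hbase.
- by rewrite eq_sym.
- by exists y.
- by exists x.
move=> U; rewrite inE => /and3P[iU /eqP cU iNU].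
have notU z : clique_of z = i -> z \notin U.
  by move=> ez; apply: contraNN iNU => zU; rewrite -ez imset_f.
split; rewrite ?notU //.
rewrite eF' !inE eqxx andbT independentU_pend //=; last first.
  by move=> v vU; apply: contraNneq iNU => <-; apply: imset_f.
by rewrite cardsU1 notU // cU; apply/eqP; lia.
Qed.

End PendantComplete.

Theorem theorem5 (n r : nat) (s : 'I_n -> nat)
    (n_gt0 : 0 < n) (r_gt0 : 0 < r) (le_2r_n : 2 * r <= n)
    (s_gt0 : forall i : 'I_n, 0 < s i) :
  EKR (gen_pendant_complete s) r.
Proof.
move=> F lF.
have [v hv] := largest_common_vertex s_gt0 n_gt0 r_gt0 le_2r_n lF.
by exists v; apply: largest_star.
Qed.
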